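(* For all $n\ge1$: (1) $R_n(1/2/3)=\{\sigma\in\Pi_n:\sigma\text{ has at most 2 blocks}\}$ and $\#R_n(1/2/3)=2^{n-1}$; (2) $R_n(123)=\{\sigma\in\Pi_n:\sigma\text{ is a matching}\}$ and $\#R_n(123)=\sum_{i\ge0}\binom n{2i}(2i)!!$; (3) $R_n(12/3)$ is the set of $\sigma\in\Pi_n$ for which there exists $k\in[0,n]$ such that $\sigma_{\le k}=1/2/\ldots/k$ and $\sigma_{>k}$ is layered with blocks $D_1,\ldots,D_t$ listed left to right satisfying $B(D_1)>B(D_2)>\cdots>B(D_t)$; and $\#R_n(12/3)=2^{n-1}$; (4) $R_n(1/23)=\{\sigma=C_1/\ldots/C_l\in\Pi_n\text{ (canonical order)}:\#C_i=1\text{ for all }i\ge2\}$ and $\#R_n(1/23)=2^{n-1}$; (5) $R_n(13/2)=\{\sigma\in\Pi_n:\sigma\text{ is layered}\}$ and $\#R_n(13/2)=2^{n-1}$.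
   Context: $[n]=\{1,\ldots,n\}$, $[a,b]=\{a,\ldots,b\}$; $\Pi_n$ is the set of partitions of $[n]$, written with slashes between blocks. A partition $\pi=B_1/\ldots/B_k$ is in canonical order if $\min B_1<\cdots<\min B_k$; for $S$ contained in a block of $\sigma$, $B(S)$ is the index of the block of $\sigma$ containing $S$ in canonical order. The restricted growth function of $\pi\in\Pi_n$ is $\rho(\pi)=a_1\ldots a_n$ with $a_i=B(\{i\})$. A sequence contains $r$ if some subsequence standardizes (order-preserving relabeling of values onto $1,2,\ldots$) to $r$. $\sigma$ R-contains $\pi$ if $\rho(\sigma)$ contains $\rho(\pi)$, otherwise R-avoids $\pi$; $R_n(\pi)$ is the set of $\sigma\in\Pi_n$ R-avoiding $\pi$. For $T\subseteq[n]$, $\sigma_T$ is the partition of $T$ with blocks the nonempty $C\cap T$, $C\in\sigma$; $\sigma_{\le k}=\sigma_{[k]}$, $\sigma_{>k}=\sigma_{[k+1,n]}$. A matching is a partition with all blocks of size at most 2; $(2i)!!=1\cdot3\cdots(2i-1)$, $(0)!!=1$. A partition (of a set of consecutive integers) is layered if all its blocks are intervals of consecutive integers. *)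

(* Defs.v *)
From mathcomp Require Import all_boot.
Set Implicit Arguments. Unset Strict Implicit. Unset Printing Implicit Defensive.

(* Convention: [n] = {1,...,n} is represented by 'I_n, element i : 'I_n
   standing for i+1 (an order-preserving relabelling).  A partition of [n]
   is P : {set {set 'I_n}} with [partition P [set: 'I_n]]. *)

Definition is_setpart n (P : {set {set 'I_n}}) := partition P [set: 'I_n].

(* index (1-based) of block C in canonical order: 1 + number of blocks D
   whose minimum is smaller than the minimum of C *)
Definition bidx n (P : {set {set 'I_n}}) (C : {set 'I_n}) : nat :=
  #|[set D in P | [exists x in D, forall y in C, x < y]]|.+1.

Definition rgf n (P : {set {set 'I_n}}) : seq nat :=
  [seq bidx P (pblock P i) | i <- enum 'I_n].

(* standardization: order-preserving relabelling of values onto 1,2,... *)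
Definition std (t : seq nat) : seq nat :=
  [seq (size (undup [seq y <- t | y < x])).+1 | x <- t].

Definition contains (s r : seq nat) : bool :=
  [exists m : (size s).-tuple bool, std (mask m s) == r].

Definition Rcontains n m (sigma : {set {set 'I_n}}) (pi : {set {set 'I_m}}) :=
  contains (rgf sigma) (rgf pi).

Definition Ravoid_set n m (pi : {set {set 'I_m}}) : {set {set {set 'I_n}}} :=
  [set P | is_setpart P & ~~ Rcontains P pi].

Definition restr n (P : {set {set 'I_n}}) (T : {set 'I_n}) : {set {set 'I_n}} :=
  [set C :&: T | C in P] :\ set0.

Definition low n (k : nat) : {set 'I_n} := [set i : 'I_n | i < k].
Definition high n (k : nat) : {set 'I_n} := [set i : 'I_n | k <= i].

Definition is_interval n (D : {set 'I_n}) : bool :=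
  [forall x in D, forall z in D, forall y : 'I_n, (x <= y <= z) ==> (y \in D)].

Definition layered n (Q : {set {set 'I_n}}) : bool :=
  [forall D in Q, is_interval D].

Definition matching n (P : {set {set 'I_n}}) : bool :=
  [forall C in P, #|C| <= 2].

(* (2i)!! = 1 * 3 * ... * (2i-1) *)
Definition dfact (i : nat) : nat := \prod_(j < i) (j.*2).+1.

Definition o0 : 'I_3 := @Ordinal 3 0 isT.
Definition o1 : 'I_3 := @Ordinal 3 1 isT.
Definition o2 : 'I_3 := @Ordinal 3 2 isT.

Definition pat_1_2_3 : {set {set 'I_3}} := [set [set o0]; [set o1]; [set o2]].
Definition pat_123   : {set {set 'I_3}} := [set [set o0; o1; o2]].
Definition pat_12_3  : {set {set 'I_3}} := [set [set o0; o1]; [set o2]].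
Definition pat_1_23  : {set {set 'I_3}} := [set [set o0]; [set o1; o2]].
Definition pat_13_2  : {set {set 'I_3}} := [set [set o0; o2]; [set o1]].

Definition cond3 n (P : {set {set 'I_n}}) : bool :=
  [exists k : 'I_n.+1,
    [&& restr P (low n k) == [set [set i] | i in low n k],
        layered (restr P (high n k)) &
        [forall D in restr P (high n k), forall D' in restr P (high n k),
           [forall x in D, forall y in D', x < y] ==>
           [forall C in P, forall C' in P,
              ((D \subset C) && (D' \subset C')) ==> (bidx P C' < bidx P C)]]]].

(* Main.v *)
Require Import Defs.
From mathcomp Require Import all_boot zify.
Set Implicit Arguments. Unset Strict Implicit. Unset Printing Implicit Defensive.

(* A partition P of [n] is determined by the map b sending each element to the
   minimum of its block; such maps are exactly the idempotent b with b i <= i.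
   The restricted growth function of P and b induce the same order on [n], so
   R-containing a partition of [3] is a condition on b at some i < j < k.

   Four of the families correspond to the 2^(n-1) subsets S of [n] containing
   the least element: for 1/2/3 and 1/23, S is the first block; for 13/2
   (layered partitions), S is the set of block minima; for 12/3, S is the set
   of values of i - b i.  The matchings are counted by removing the block of a
   given point, which gives M(n+2) = M(n+1) + (n+1) M(n). *)

(** * Block minima *)

Definition bmin n (P : {set {set 'I_n}}) (i : 'I_n) : 'I_n :=
  [arg min_(j < i in pblock P i) j].

Section Blocks.
Variables (n : nat) (P : {set {set 'I_n}}).
Hypothesis partP : is_setpart P.

Lemma mem_pblockT i : i \in pblock P i.
Proof. by rewrite mem_pblock (cover_partition partP). Qed.

Lemma pblock_memT i : pblock P i \in P.
Proof. by rewrite pblock_mem // (cover_partition partP). Qed.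

Lemma block_pblock C : C \in P -> exists i, C = pblock P i.
Proof.
move=> CP; have /set0Pn [i iC] : C != set0.
  by apply: contraTneq CP => ->; rewrite (partition0 partP).
by exists i; rewrite (def_pblock (partition_trivIset partP) CP iC).
Qed.

Lemma bmin_mem i : bmin P i \in pblock P i.
Proof. by rewrite /bmin; case: arg_minnP => //; apply: mem_pblockT. Qed.

Lemma bmin_min i j : j \in pblock P i -> bmin P i <= j.
Proof.
by rewrite /bmin; case: arg_minnP => [|k _ min_k /min_k //]; apply: mem_pblockT.
Qed.

Lemma bmin_le i : bmin P i <= i.
Proof. exact/bmin_min/mem_pblockT. Qed.

(** Two blocks with the same minimum meet, hence coincide by disjointness. This turns membership in
    a block into an equation between minima. *)
Lemma pblock_bminE i j : (j \in pblock P i) = (bmin P i == bmin P j).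
Proof.
have eqE : (pblock P i == pblock P j) = (j \in pblock P i).
  by rewrite eq_pblock ?(cover_partition partP) ?(partition_trivIset partP).
apply/idP/eqP => [|eq_ij].
  rewrite -eqE => /eqP eq_ij; apply/val_inj/anti_leq/andP; split.
    by rewrite bmin_min // eq_ij bmin_mem.
  by rewrite bmin_min // -eq_ij bmin_mem.
have tI := partition_trivIset partP; rewrite -eqE; apply/eqP.
by rewrite -(same_pblock tI (bmin_mem i)) eq_ij (same_pblock tI (bmin_mem j)).
Qed.

Lemma bmin_idem i : bmin P (bmin P i) = bmin P i.
Proof. by apply/esym/eqP; rewrite -pblock_bminE bmin_mem. Qed.

(** [pblock P] maps the fixed points of [bmin P] bijectively onto the blocks, so the blocks that
    start earlier can be counted by their minima. *)
Lemma bidx_bmin i :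
  bidx P (pblock P i) = #|[set x | bmin P x == x & x < bmin P i]|.+1.
Proof.
congr _.+1; rewrite -(card_in_imset (f := pblock P)); last first.
  move=> x y; rewrite !inE => /andP[/eqP bx _] /andP[/eqP by_ _] eq_xy.
  by apply/eqP; rewrite -bx -by_ -pblock_bminE eq_xy mem_pblockT.
apply: eq_card => D; rewrite !inE; apply/andP/imsetP.
  case=> /block_pblock [x ->] /exists_inP[y yD /forall_inP lty].
  exists (bmin P x).
    rewrite inE bmin_idem eqxx (leq_ltn_trans (bmin_min yD)) //.
    by apply: lty; apply: bmin_mem.
  by apply/eqP; rewrite eq_pblock ?(cover_partition partP) ?bmin_mem //;
    apply: partition_trivIset partP.
case=> x; rewrite inE => /andP[/eqP bx ltxi] ->; split; first exact: pblock_memT.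
apply/exists_inP; exists x; first exact: mem_pblockT.
by apply/forall_inP => y /bmin_min; apply: leq_trans.
Qed.

Lemma bidx_le i j : bmin P i <= bmin P j ->
  bidx P (pblock P i) <= bidx P (pblock P j).
Proof.
move=> le_ij; rewrite !bidx_bmin ltnS; apply/subset_leq_card/subsetP => x.
by rewrite !inE => /andP[-> /leq_trans -> //].
Qed.

Lemma bidx_ltE i j :
  (bidx P (pblock P i) < bidx P (pblock P j)) = (bmin P i < bmin P j).
Proof.
apply/idP/idP => [|lt_ij]; first by apply: contraTT; rewrite -!leqNgt; apply: bidx_le.
rewrite !bidx_bmin ltnS; apply/proper_card/properP; split.
  by apply/subsetP => x; rewrite !inE => /andP[-> /ltn_trans ->].
(* The inclusion is strict: the minimum of the earlier block is counted only for [j]. *)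
by exists (bmin P i); rewrite !inE bmin_idem eqxx ?ltnn.
Qed.

End Blocks.

(** * Partitions into the fibres of a map *)

Definition retraction n (h : 'I_n -> 'I_n) :=
  forall i, h i <= i /\ h (h i) = h i.

Lemma preim_setpart n (rT : eqType) (h : 'I_n -> rT) : is_setpart (preim_partition h setT).
Proof. exact: preim_partitionP. Qed.

Lemma preim_pblock n (rT : eqType) (h : 'I_n -> rT) i j :
  (j \in pblock (preim_partition h setT) i) = (h i == h j).
Proof.
by rewrite pblock_equivalence_partition ?inE // => ? ? ? _ _ _; split => // /eqP ->.
Qed.

(** By idempotence [h i] lies in the fibre of [i], and [h j <= j] puts it below every [j] of that
    fibre. *)
Lemma bmin_preim n (h : 'I_n -> 'I_n) : retraction h ->
  bmin (preim_partition h setT) =1 h.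
Proof.
move=> rh i; have pP := preim_setpart h.
have := bmin_mem pP i; rewrite preim_pblock => /eqP e1.
apply/val_inj/anti_leq; rewrite bmin_min ?preim_pblock ?(rh i).2 //.
by rewrite e1 (rh _).1.
Qed.

(** * Occurrences of patterns *)

(** Masks of the growth function correspond to increasing lists of positions, which are easier to
    handle. *)
Lemma Rcontains_nat n (P : {set {set 'I_n}}) m (pi : {set {set 'I_m}}) :
  Rcontains P pi <->
  exists2 u : seq 'I_n, sorted ltn (map val u) &
    std [seq bidx P (pblock P i) | i <- u] = rgf pi.
Proof.
rewrite /Rcontains /contains; split.
  case/existsP => t /eqP <-; rewrite /rgf -map_mask.
  exists (mask t (enum 'I_n)) => //.
  by rewrite map_mask val_enum_ord sorted_mask ?iota_ltn_sorted //; apply: ltn_trans.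
case=> u su eq_u; apply/existsP.
have : subseq u (enum 'I_n).
  (* An increasing list is the enumeration filtered by its own members: both are sorted and have the
     same elements. *)
  suff -> : u = [seq i <- enum 'I_n | i \in u] by apply: filter_subseq.
  apply: (inj_map val_inj); apply: (irr_sorted_eq ltn_trans ltnn) => //.
    rewrite sorted_map; apply: sorted_filter; first by move=> ? ? ?; apply: ltn_trans.
    by rewrite -sorted_map val_enum_ord iota_ltn_sorted.
  by move=> x; apply/mapP/mapP => -[i iu ->]; exists i => //;
    move: iu; rewrite mem_filter ?mem_enum ?andbT.
case/subseqP => t st eq_t.
have sz : size t == size (rgf P) by rewrite size_map st.
by exists (Tuple sz); rewrite /= /rgf -map_mask -eq_t eq_u.
Qed.

Lemma std3E a b c :
  [/\ (std [:: a; b; c] == [:: 1; 2; 3]) = (a < b < c),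
      (std [:: a; b; c] == [:: 1; 1; 1]) = (a == b) && (b == c),
      (std [:: a; b; c] == [:: 1; 1; 2]) = (a == b) && (b < c),
      (std [:: a; b; c] == [:: 1; 2; 2]) = (a < b) && (b == c) &
      (std [:: a; b; c] == [:: 1; 2; 1]) = (a < b) && (a == c)].
Proof.
rewrite /std /= !ltnn.
by case: (ltngtP a b) => ab; case: (ltngtP a c) => ac;
  case: (ltngtP b c) => bc /=; subst; rewrite ?inE ?eqxx ?ltnn //=;
  try lia; case: ifP => // /eqP; lia.
Qed.

Lemma Rcontains3 n (P : {set {set 'I_n}}) (pi : {set {set 'I_3}}) :
  Rcontains P pi <-> exists i j k : 'I_n,
    [/\ i < j, j < k &
        std [:: bidx P (pblock P i); bidx P (pblock P j); bidx P (pblock P k)]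
        = rgf pi].
Proof.
rewrite Rcontains_nat; split=> [[u su eq_u]|[i [j [k [ij jk e]]]]]; last first.
  by exists [:: i; j; k] => //=; rewrite ij jk.
have : size u = 3.
  by have := congr1 size eq_u; rewrite /rgf !size_map -enumT size_enum_ord.
by case: u su eq_u => [|i [|j [|k []]]] //= /and3P[ij jk _] e _; exists i, j, k.
Qed.

(** * Growth functions of the five partitions of [3] *)

Definition word3 (s : seq 'I_3) (i : 'I_3) := nth o0 s i.

(** The cardinals in [bidx] become sums over three points, which unfold to numerals. *)
Lemma rgf_word3 (s : seq 'I_3) (h := word3 s) : retraction h ->
  rgf (preim_partition h setT) =
  [seq (\sum_(x < 3) ((h x == x) && (x < h i))).+1 | i <- [:: o0; o1; o2]].
Proof.
move=> rh; have -> : [:: o0; o1; o2] = enum 'I_3.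
  by apply: (inj_map val_inj); rewrite val_enum_ord.
apply: eq_map => i; rewrite bidx_bmin; last exact: preim_setpart.
congr _.+1; rewrite -sum1_card [LHS]big_mkcond; apply: eq_bigr => x _.
by rewrite inE !bmin_preim //; case: andP.
Qed.

Lemma preim_word3 (s : seq 'I_3) (h := word3 s) :
  preim_partition h setT =
  [set [set x | h o0 == h x]; [set x | h o1 == h x]; [set x | h o2 == h x]].
Proof.
rewrite /preim_partition /equivalence_partition.
have -> : [set: 'I_3] = [set o0; o1; o2].
  by apply/setP => -[[|[|[|]]]] // ?; rewrite !inE.
by rewrite !imsetU !imset_set1; congr [set _; _; _]; apply/setP;
  case=> -[|[|[|]]] // ?; rewrite ?inE.
Qed.

Lemma rgf_pats :
  [/\ rgf pat_1_2_3 = [:: 1; 2; 3], rgf pat_123 = [:: 1; 1; 1],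
      rgf pat_12_3 = [:: 1; 1; 2], rgf pat_1_23 = [:: 1; 2; 2] &
      rgf pat_13_2 = [:: 1; 2; 1]].
Proof.
have rgfE (s : seq 'I_3) pi r : retraction (word3 s) ->
    preim_partition (word3 s) setT = pi ->
    [seq (\sum_(x < 3) ((word3 s x == x) && (x < word3 s i))).+1
      | i <- [:: o0; o1; o2]] = r ->
    rgf pi = r.
  by move=> rs <- <-; apply: rgf_word3.
have retr (s : seq 'I_3) :
    all (fun i => (word3 s i <= i) && (word3 s (word3 s i) == word3 s i))
      [:: o0; o1; o2] -> retraction (word3 s).
  move/allP=> rs i; have /rs : i \in [:: o0; o1; o2].
    by rewrite !inE; case: i => [[|[|[|]]]].
  by case/andP => ? /eqP.
split.
- apply: (rgfE [:: o0; o1; o2]); first exact: retr.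
    rewrite preim_word3; congr [set _; _; _];
      by apply/setP => -[[|[|[|]]]] // ?; rewrite !inE.
  by rewrite /= !big_ord_recl !big_ord0.
- apply: (rgfE [:: o0; o0; o0]); first exact: retr.
    rewrite preim_word3 -!setUA !setUid; congr [set _];
      by apply/setP => -[[|[|[|]]]] // ?; rewrite !inE.
  by rewrite /= !big_ord_recl !big_ord0.
- apply: (rgfE [:: o0; o0; o2]); first exact: retr.
    rewrite preim_word3 !setUid; congr [set _; _];
      by apply/setP => -[[|[|[|]]]] // ?; rewrite !inE.
  by rewrite /= !big_ord_recl !big_ord0.
- apply: (rgfE [:: o0; o1; o1]); first exact: retr.
    rewrite preim_word3 -setUA !setUid; congr [set _; _];
      by apply/setP => -[[|[|[|]]]] // ?; rewrite !inE.
  by rewrite /= !big_ord_recl !big_ord0.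
- apply: (rgfE [:: o0; o1; o0]); first exact: retr.
    rewrite preim_word3 setUAC setUid; congr [set _; _];
      by apply/setP => -[[|[|[|]]]] // ?; rewrite !inE.
  by rewrite /= !big_ord_recl !big_ord0.
Qed.

(** * Avoidance of each pattern in terms of blocks *)

Lemma card_gt1_ltn n (A : {set 'I_n}) :
  1 < #|A| -> exists i j : 'I_n, [/\ i \in A, j \in A & i < j].
Proof.
case/card_gt1P => i [j [iA jA]]; case: (ltngtP i j) => [ij|ji|/val_inj ->]; last by rewrite eqxx.
  by exists i, j.
by exists j, i.
Qed.

Lemma card_gt2_ltn n (A : {set 'I_n}) : 2 < #|A| ->
  exists i j k : 'I_n, [/\ i \in A, j \in A & k \in A] /\ i < j < k.
Proof.
case/card_gt2P => i [j [k [[iA jA kA]]]]; rewrite -!(inj_eq val_inj) => -[].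
case: (ltngtP i j) => // ij _; case: (ltngtP j k) => // jk _;
  case: (ltngtP k i) => // ki _; first [by lia
  | by exists i, j, k; split=> //; apply/andP | by exists i, k, j; split=> //; apply/andP
  | by exists j, i, k; split=> //; apply/andP | by exists j, k, i; split=> //; apply/andP
  | by exists k, i, j; split=> //; apply/andP | by exists k, j, i; split=> //; apply/andP].
Qed.

Section Patterns.
Variables (n : nat) (P : {set {set 'I_n}}).
Hypothesis partP : is_setpart P.
Local Notation b := (bmin P).

Lemma bidx_eqE i j :
  (bidx P (pblock P i) == bidx P (pblock P j)) = (b i == b j).
Proof.
rewrite -(inj_eq val_inj) /= !eqn_leq.
by rewrite leqNgt (bidx_ltE partP) -leqNgt [in X in _ && X]leqNgt (bidx_ltE partP) -leqNgt.
Qed.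

Lemma Rcontains_bmin :
  [/\ Rcontains P pat_1_2_3 <->
        exists i j k : 'I_n, [/\ i < j, j < k & b i < b j < b k],
      Rcontains P pat_123 <->
        exists i j k : 'I_n, [/\ i < j, j < k & (b i == b j) && (b j == b k)],
      Rcontains P pat_12_3 <->
        exists i j k : 'I_n, [/\ i < j, j < k & (b i == b j) && (b j < b k)],
      Rcontains P pat_1_23 <->
        exists i j k : 'I_n, [/\ i < j, j < k & (b i < b j) && (b j == b k)] &
      Rcontains P pat_13_2 <->
        exists i j k : 'I_n, [/\ i < j, j < k & (b i < b j) && (b i == b k)]].
Proof.
have [r1 r2 r3 r4 r5] := rgf_pats.
split; rewrite Rcontains3 ?(r1, r2, r3, r4, r5); split=> -[i [j [k [ij jk e]]]];
  exists i, j, k; split=> //; move: e;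
  have [s1 s2 s3 s4 s5] := std3E (bidx P (pblock P i)) (bidx P (pblock P j))
    (bidx P (pblock P k));
  rewrite ?bidx_eqE ?(bidx_ltE partP) in s1 s2 s3 s4 s5;
  by [move/eqP; rewrite (s1, s2, s3, s4, s5)
     | move=> e; apply/eqP; rewrite (s1, s2, s3, s4, s5)].
Qed.

Lemma card_bmin : #|P| = #|[set x | b x == x]|.
Proof.
rewrite -(card_in_imset (f := pblock P)); last first.
  move=> x y; rewrite !inE => /eqP bx /eqP by_ eq_xy.
  by apply/eqP; rewrite -bx -by_ -(pblock_bminE partP) eq_xy mem_pblockT.
apply: eq_card => C; apply/idP/imsetP => [/(block_pblock partP) [i ->]|[x _ ->]];
  last exact: pblock_memT.
exists (b i); first by rewrite inE bmin_idem.
apply/eqP; rewrite eq_pblock ?(cover_partition partP) ?bmin_mem //.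
exact: partition_trivIset partP.
Qed.

(** An occurrence has three distinct block minima; conversely the minima of three blocks, in
    increasing order, form an occurrence. *)
Lemma Rcontains_1_2_3 : Rcontains P pat_1_2_3 = (2 < #|P|).
Proof.
have [e _ _ _ _] := Rcontains_bmin; rewrite card_bmin; apply/idP/idP => [/e|].
  case=> i [j [k [_ _ /andP[ij jk]]]]; apply/card_gt2P; exists (b i), (b j), (b k).
  by rewrite !inE !(bmin_idem partP) !eqxx -!(inj_eq val_inj) /=; split=> //; split; lia.
case/card_gt2_ltn => i [j [k [[]]]]; rewrite !inE => /eqP bi /eqP bj /eqP bk /andP[ij jk].
by apply/e; exists i, j, k; rewrite bi bj bk; split=> //; apply/andP.
Qed.

Lemma Rcontains_123 : Rcontains P pat_123 = ~~ matching P.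
Proof.
have [_ e _ _ _] := Rcontains_bmin; apply/idP/forall_inPn => [/e|].
  case=> i [j [k [ij jk /andP[/eqP bij /eqP bjk]]]].
  exists (pblock P i); first exact: pblock_memT.
  rewrite -ltnNge; apply/card_gt2P; exists i, j, k.
  rewrite !(pblock_bminE partP) -!bjk -!bij -!(inj_eq val_inj) /=.
  by split=> //; split; lia.
case=> C /(block_pblock partP) [x ->]; rewrite -ltnNge => /card_gt2_ltn [i [j [k [[]]]]].
rewrite !(pblock_bminE partP) => /eqP bi /eqP bj /eqP bk /andP[ij jk].
by apply/e; exists i, j, k; rewrite -bi -bj -bk eqxx.
Qed.

Lemma Rcontains_13_2 : Rcontains P pat_13_2 = ~~ layered P.
Proof.
have [_ _ _ _ e] := Rcontains_bmin; apply/idP/forall_inPn => [/e|].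
  case=> i [j [k [ij jk /andP[bij /eqP bik]]]].
  exists (pblock P i); first exact: pblock_memT.
  apply/negP => /forall_inP /(_ _ (mem_pblockT partP i)) /forall_inP /(_ k).
  rewrite (pblock_bminE partP) bik eqxx => /(_ isT) /forallP /(_ j).
  by rewrite (pblock_bminE partP) (ltnW ij) (ltnW jk) //= => /eqP bE; rewrite bE ltnn in bij.
case=> C /(block_pblock partP) [i ->].
case/forall_inPn => x; rewrite (pblock_bminE partP) => /eqP bx.
case/forall_inPn => z; rewrite (pblock_bminE partP) => /eqP bz.
case/forallPn => y; rewrite (pblock_bminE partP) negb_imply => /andP[/andP[xy yz] ni].
(* The gap [y] lies in a block starting after or before that of [x]. In the first case [x], [y], [z]
   is an occurrence, in the second [b y], [x], [y]. *)
apply/e; case: (ltngtP (b x) (b y)) => bxy.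
- exists x, y, z; rewrite bxy -bx bz eqxx; split=> //.
    by rewrite ltn_neqAle xy andbT; apply: contraTneq bxy => /val_inj ->; rewrite ltnn.
  by rewrite ltn_neqAle yz andbT; apply: contraNneq ni => /val_inj ->; apply/eqP.
- exists (b y), x, y; rewrite (bmin_idem partP) eqxx bxy; split=> //.
    by rewrite (leq_trans bxy) ?(bmin_le partP).
  by rewrite ltn_neqAle xy andbT; apply: contraNneq ni => /val_inj <-; apply/eqP.
- by move: ni; rewrite bx (val_inj bxy) eqxx.
Qed.

(** Elements are numbered from 0, so the first block is the one whose minimum is 0. *)
Lemma bidx_ge2 i : (2 <= bidx P (pblock P i)) = (0 < b i).
Proof.
rewrite (bidx_bmin partP) ltnS; apply/card_gt0P/idP => [[x]|b0].
  by rewrite inE => /andP[_]; apply: leq_ltn_trans.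
pose z := Ordinal (ltn_trans b0 (ltn_ord (b i))).
exists z; rewrite inE b0 andbT -(inj_eq val_inj) /=.
by rewrite -leqn0 (bmin_le partP z).
Qed.

(** Two elements of one block other than the first, preceded by the element 0, form an occurrence;
    conversely the repeated letter of an occurrence exceeds another letter, so its block is not the
    first. *)
Lemma Rcontains_1_23 : Rcontains P pat_1_23 =
  ~~ [forall C in P, (2 <= bidx P C) ==> (#|C| == 1)].
Proof.
have [_ _ _ e _] := Rcontains_bmin; apply/idP/forall_inPn => [/e|].
  case=> i [j [k [ij jk /andP[bij /eqP bjk]]]].
  exists (pblock P j); first exact: pblock_memT.
  rewrite bidx_ge2 (leq_trans _ bij) // implyTb neq_ltn; apply/orP; right.
  apply/card_gt1P; exists j, k.
  by rewrite !(pblock_bminE partP) -!bjk eqxx; split=> //; rewrite neq_ltn jk.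
case=> C /(block_pblock partP) [x ->]; rewrite bidx_ge2 negb_imply => /andP[bx].
rewrite neq_ltn ltnS leqn0 cards_eq0 -[_ == set0]negbK.
have -> /= : pblock P x != set0 by apply/set0Pn; exists x; apply: mem_pblockT.
case/card_gt1_ltn => j [k []]; rewrite !(pblock_bminE partP) => /eqP bj /eqP bk jk.
pose z := Ordinal (ltn_trans bx (ltn_ord (b x))).
have bz : b z = 0 :> nat by apply/eqP; rewrite -leqn0 (bmin_le partP z).
apply/e; exists z, j, k; rewrite -bj -bk eqxx bz bx; split=> //.
by rewrite (leq_trans bx) // bj (bmin_le partP).
Qed.

End Patterns.

(* For RGFs avoiding 112: b is the identity below k, and is bounded by k and
   weakly decreasing from k on. *)
Definition staircase n (b : 'I_n -> 'I_n) (k : nat) :=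
  [/\ forall i : 'I_n, i < k -> b i = i,
      forall i : 'I_n, k <= i -> b i < k &
      forall i j : 'I_n, k <= i -> i <= j -> b j <= b i].

(** * Avoidance of 12/3 *)

Section Staircase.
Variables (n : nat) (P : {set {set 'I_n}}).
Hypothesis partP : is_setpart P.
Local Notation b := (bmin P).

(** Two equal letters cannot both lie below [k], where [b] is the identity, and from [k] on no
    letter increases. *)
Lemma staircase_avoid k : staircase b k -> ~~ Rcontains P pat_12_3.
Proof.
have [_ _ e _ _] := Rcontains_bmin partP.
case=> bid _ bdec; apply/negP => /e [i [j [l [ij jl /andP[/eqP bij bjl]]]]].
case: (ltnP j k) => jk; last by rewrite ltnNge bdec // ltnW in bjl.
by move: bij; rewrite !bid // ?(ltn_trans ij) // => eij; rewrite eij ltnn in ij.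
Qed.

(** Take for [k] the least element moved by [b], or [n] if there is none. Each [i >= k] repeats the
    letter of [b i < k], so no larger letter may follow it. *)
Lemma avoid_staircase : ~~ Rcontains P pat_12_3 ->
  exists k : 'I_n.+1, staircase b k.
Proof.
have [_ _ e _ _] := Rcontains_bmin partP => /negP avP.
have {avP}H (i j l : 'I_n) : i < j -> j < l -> b i = b j -> b l <= b j.
  move=> ij jl bij; rewrite leqNgt; apply/negP => lt; apply: avP; apply/e.
  by exists i, j, l; rewrite bij eqxx.
have [/forallP bid|/forallPn [i0 bi0]] := boolP [forall i, b i == i].
  exists ord_max; split=> /= i; first by move/eqP: (bid i).
    by rewrite leqNgt ltn_ord.
  by move=> j; rewrite leqNgt ltn_ord.
case: (@arg_minnP _ i0 (fun i => b i != i) val bi0) => k bk mink.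
have bid (i : 'I_n) : i < k -> b i = i.
  by move=> ik; apply/eqP; apply: contraTT ik => /mink; rewrite -leqNgt.
have bk_lt : b k < k.
  by rewrite ltn_neqAle (bmin_le partP) andbT (inj_eq val_inj).
(* The minimum [b i] is not [k], which [b] moves, and not beyond [k], since [b k], [k], [b i] would
   be an occurrence. *)
have b_lt (i : 'I_n) : k <= i -> b i < k.
  move=> ki; rewrite ltnNge; apply/negP; rewrite leq_eqVlt => /orP[/eqP/val_inj ek|lt].
    by move: bk; rewrite ek bmin_idem ?eqxx.
  have := H _ _ _ bk_lt lt; rewrite !bmin_idem // => /(_ erefl); lia.
exists (widen_ord (leqnSn n) k); split=> //= i j ki.
rewrite leq_eqVlt => /orP[/eqP/val_inj -> //|ij].
by apply: (H (b i)); rewrite ?bmin_idem // (leq_trans (b_lt _ ki)).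
Qed.

(** Indexing the traces by representatives in [T] takes care of the removal of the empty set. *)
Lemma restrP (T D : {set 'I_n}) :
  reflect (exists2 i, i \in T & D = pblock P i :&: T) (D \in restr P T).
Proof.
rewrite !inE; apply: (iffP andP) => [[/set0Pn [x xD] /imsetP [C CP eD]]|[i iT ->]].
  move: xD; rewrite eD inE => /andP[xC xT]; exists x => //.
  by rewrite (def_pblock (partition_trivIset partP) CP xC).
split; last by apply/imset_f/(pblock_memT partP).
by apply/set0Pn; exists i; rewrite inE iT mem_pblockT.
Qed.

(** A weakly decreasing [b] takes each value on an interval, and intervals further right carry
    smaller minima, hence smaller indices. *)
Lemma staircase_cond3 (k : 'I_n.+1) : staircase b k -> cond3 P.
Proof.
case=> bid blt bdec; apply/existsP; exists k; apply/and3P; split.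
- apply/eqP/setP => D; apply/restrP/imsetP => -[i]; rewrite inE => ik ->;
    exists i; rewrite ?inE //; apply/setP => j; rewrite !inE (pblock_bminE partP);
    have [jk|jk] := ltnP j k; rewrite ?andbT ?andbF ?bid //; first [exact: eq_sym|idtac].
  + by apply/esym/negbTE; rewrite neq_ltn (leq_trans ik jk) orbT.
  + by apply/negbTE; rewrite neq_ltn (leq_trans ik jk) orbT.
- apply/forall_inP => D /restrP [i]; rewrite inE => ki ->.
  apply/forall_inP => x; rewrite !inE (pblock_bminE partP) => /andP[/eqP bx kx].
  apply/forall_inP => z; rewrite !inE (pblock_bminE partP) => /andP[/eqP bz kz].
  apply/forallP => y; apply/implyP => /andP[xy yz].
  rewrite !inE (pblock_bminE partP) (leq_trans kx xy) andbT.
  apply/eqP/val_inj/anti_leq; rewrite [in X in X && _]bz [in X in _ && X]bx.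
  by rewrite !bdec // (leq_trans kx).
- apply/forall_inP => D /restrP [i iT ->]; apply/forall_inP => D' /restrP [j jT ->].
  have iD : i \in pblock P i :&: high n k by rewrite inE iT mem_pblockT.
  have jD : j \in pblock P j :&: high n k by rewrite inE jT mem_pblockT.
  apply/implyP => /forall_inP lt.
  have {}lt x y : x \in pblock P i :&: high n k -> y \in pblock P j :&: high n k -> x < y.
    by move=> /lt /forall_inP; apply.
  apply/forall_inP => C CP; apply/forall_inP => C' CP'; apply/implyP => /andP[sC sC'].
  have tI := partition_trivIset partP.
  rewrite -(def_pblock tI CP (subsetP sC _ iD)) -(def_pblock tI CP' (subsetP sC' _ jD)).
  rewrite (bidx_ltE partP) ltn_neqAle bdec ?andbT; last by apply/ltnW/lt.
    (* If the minima agreed, [i] would lie in both traces, and [lt] would give [i < i]. *)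
    apply/negP => /eqP /val_inj bij.
    suff : i < i by rewrite ltnn.
    by apply: lt => //; rewrite inE iT (pblock_bminE partP) bij eqxx.
  by move: iT; rewrite inE.
Qed.

(** In an occurrence [i], [j], [l], if [j < k] then the trace of a block below [k] contains both [i]
    and [j] and is no singleton. Otherwise the traces of [j] and [l] are disjoint intervals from
    left to right, whose indices must decrease, against [b j < b l]. *)
Lemma cond3_avoid : cond3 P -> ~~ Rcontains P pat_12_3.
Proof.
have [_ _ e _ _] := Rcontains_bmin partP.
case/existsP => k /and3P[/eqP lowP layP decP].
apply/negP => /e [i [j [l [ij jl /andP[/eqP bij bjl]]]]].
case: (ltnP j k) => jk.
  have : pblock P i :&: low n k \in restr P (low n k).
    by apply/restrP; exists i => //; rewrite inE (ltn_trans ij).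
  rewrite lowP => /imsetP [p _ /setP e1].
  have := e1 i; have := e1 j.
  rewrite !inE !(pblock_bminE partP) bij eqxx jk (ltn_trans ij jk) /=.
  by move=> /esym/eqP ej /esym/eqP ei; rewrite ei ej ltnn in ij.
have kl := leq_ltn_trans jk jl.
have Dj : pblock P j :&: high n k \in restr P (high n k).
  by apply/restrP; exists j; rewrite ?inE.
have Dl : pblock P l :&: high n k \in restr P (high n k).
  by apply/restrP; exists l; rewrite // inE ltnW.
have conv (c x y z : 'I_n) : pblock P c :&: high n k \in restr P (high n k) ->
    k <= x -> x <= y -> y <= z -> b c = b x -> b c = b z -> b c = b y.
  move=> DR kx xy yz bx bz; move/forall_inP: layP => /(_ _ DR) /forall_inP /(_ x).
  rewrite !inE (pblock_bminE partP) bx eqxx kx => /(_ isT) /forall_inP /(_ z).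
  rewrite !inE (pblock_bminE partP) -bx bz eqxx.
  rewrite (leq_trans kx (leq_trans xy yz)) => /(_ isT) /forallP /(_ y).
  by rewrite xy yz !inE (pblock_bminE partP) -bz => /andP[/eqP].
move/forall_inP: decP => /(_ _ Dj) /forall_inP /(_ _ Dl) /implyP dec.
have nb : b j <> b l by move=> bE; rewrite bE ltnn in bjl.
suff /dec /forall_inP /(_ _ (pblock_memT partP j)) /forall_inP /(_ _ (pblock_memT partP l)) :
    [forall x in pblock P j :&: high n k, forall y in pblock P l :&: high n k, x < y].
  by rewrite !subsetIl (bidx_ltE partP) ltnNge ltnW.
apply/forall_inP => x; rewrite !inE (pblock_bminE partP) => /andP[/eqP bx kx].
apply/forall_inP => y; rewrite !inE (pblock_bminE partP) => /andP[/eqP by_ ky].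
(* If [y <= x], convexity puts [y] in the block of [j] when [j <= y], and [j] in the block of [l]
   when [y < j]. *)
rewrite ltnNge; apply/negP => yx; apply: nb; case: (leqP j y) => jy.
  by rewrite by_; apply: (conv j j y x).
by apply/esym/(conv l y j l) => //; apply: ltnW.
Qed.

Lemma avoid_12_3E : ~~ Rcontains P pat_12_3 = cond3 P.
Proof.
apply/idP/idP; last exact: cond3_avoid.
by case/avoid_staircase => k; apply: staircase_cond3.
Qed.

End Staircase.

(** * Partitions encoded by pointed subsets *)

Lemma card_pointed n : #|[set S : {set 'I_n.+1} | ord0 \in S]| = 2 ^ n.
Proof.
have -> : 2 ^ n = #|powerset [set~ @ord0 n]|.
  by rewrite card_powerset cardsC1 card_ord.
rewrite -(card_in_imset (f := fun S => ord0 |: S)).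
  apply: eq_card => S; rewrite !inE; apply/idP/imsetP => [S0|[U _ ->]].
    exists (S :\ ord0); rewrite ?setD1K // powersetE.
    by apply/subsetP => x; rewrite !inE => /andP[].
  exact: setU11.
move=> S U; rewrite !powersetE => /subsetP nS /subsetP nU e.
have noS : ord0 \notin S by apply/negP => /nS; rewrite !inE eqxx.
have noU : ord0 \notin U by apply/negP => /nU; rewrite !inE eqxx.
by rewrite -(setU1K noS) e setU1K.
Qed.

(** Counting scheme: [F] encodes a partition as a pointed set, and the fibres of [h S] decode [S].
    The third hypothesis makes [F] injective on [A], the last two make it surjective. *)
Lemma card_setparts n (A : {set {set {set 'I_n.+1}}}) (rT : eqType)
    (F : {set {set 'I_n.+1}} -> {set 'I_n.+1}) (h : {set 'I_n.+1} -> 'I_n.+1 -> rT) :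
  (forall P, P \in A -> is_setpart P) ->
  (forall P, P \in A -> ord0 \in F P) ->
  (forall P, P \in A -> forall i j,
     (j \in pblock P i) = (h (F P) i == h (F P) j)) ->
  (forall S : {set 'I_n.+1}, ord0 \in S -> preim_partition (h S) setT \in A) ->
  (forall S : {set 'I_n.+1}, ord0 \in S -> F (preim_partition (h S) setT) = S) ->
  #|A| = 2 ^ n.
Proof.
move=> partA F0 hP hA FK; rewrite -card_pointed.
have PK P : P \in A -> preim_partition (h (F P)) setT = P.
  move=> PA; rewrite -[RHS](preim_partition_pblock (partA _ PA)).
  apply: eq_in_imset => i _; apply/setP => j; rewrite !inE /=.
  rewrite -hP // eq_pblock //; first exact: partition_trivIset (partA _ PA).
  by rewrite (cover_partition (partA _ PA)).
rewrite -(card_in_imset (f := F)); last by move=> P Q PA QA e; rewrite -(PK P) // e PK.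
apply: eq_card => S; rewrite inE; apply/imsetP/idP => [[P PA ->]|S0]; first exact: F0.
by exists (preim_partition (h S) setT); rewrite ?hA ?FK.
Qed.

Lemma card_two_blocks n :
  #|[set P : {set {set 'I_n.+1}} | is_setpart P & #|P| <= 2]| = 2 ^ n.
Proof.
pose h (S : {set 'I_n.+1}) i := i \in S.
apply: (@card_setparts _ _ _ (fun P => pblock P ord0) h) => [P|P|P|S S0|S S0].
- by rewrite inE => /andP[].
- by rewrite inE => /andP[pP _]; apply: mem_pblockT.
- rewrite inE => /andP[pP]; rewrite leqNgt => /card_gt2P c3 i j.
  rewrite /h !(pblock_bminE pP).
  (* Two elements in different blocks, both outside the block of [ord0], would give three blocks. *)
  have [-> //|ij] := eqVneq (bmin P i) (bmin P j); first by rewrite eqxx.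
  case: (eqVneq (bmin P ord0) (bmin P i)) => [ei|i0];
    case: (eqVneq (bmin P ord0) (bmin P j)) => [e|j0] //.
    by rewrite -ei -e eqxx in ij.
  case: c3; exists (pblock P ord0), (pblock P i), (pblock P j).
  rewrite !pblock_memT //; split=> //.
  rewrite !eq_pblock ?(cover_partition pP) ?(partition_trivIset pP) //.
  by rewrite !(pblock_bminE pP) i0 ij eq_sym.
- rewrite inE (preim_setpart (h S)) leqNgt; apply/negP => /card_gt2P [C [D [E [[]]]]].
  have pP := preim_setpart (h S).
  move=> /(block_pblock pP) [i ->] /(block_pblock pP) [j ->] /(block_pblock pP) [k ->] [].
  rewrite !eq_pblock ?(cover_partition pP) ?(partition_trivIset pP) // !preim_pblock.
  by case: (h S i); case: (h S j); case: (h S k).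
- by apply/setP => i; rewrite preim_pblock /h S0; case: (i \in S).
Qed.

Lemma card_nonfirst_singletons n :
  #|[set P : {set {set 'I_n.+1}} | is_setpart P &
      [forall C in P, (2 <= bidx P C) ==> (#|C| == 1)]]| = 2 ^ n.
Proof.
(* For [S] containing [ord0], the fibres are [S] and the singletons outside it. *)
pose h (S : {set 'I_n.+1}) i := if i \in S then ord0 else i.
apply: (@card_setparts _ _ _ (fun P => pblock P ord0) h) => [P|P|P|S S0|S S0].
- by rewrite inE => /andP[].
- by rewrite inE => /andP[pP _]; apply: mem_pblockT.
- rewrite inE => /andP[pP /forall_inP c i j]; rewrite /h !(pblock_bminE pP).
  have b0 : bmin P ord0 = ord0 by apply/val_inj/eqP; rewrite -leqn0 (bmin_le pP ord0).
  rewrite b0; case: (eqVneq ord0 (bmin P i)) => [<-|i0].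
    by case: eqVneq => // nj; apply/esym/negbTE; apply: contraNneq nj => <-; rewrite b0.
  have : 0 < bmin P i by rewrite lt0n eq_sym.
  rewrite -(bidx_ge2 pP) => bi2.
  have /implyP/(_ bi2)/cards1P [x ex] := c _ (pblock_memT pP i).
  have : i \in pblock P i by apply: mem_pblockT.
  rewrite -(pblock_bminE pP) ex !inE => /eqP <-.
  case: (eqVneq ord0 (bmin P j)) => j0; last exact: eq_sym.
  have -> : (j == i) = false by apply: contraNF i0 => /eqP <-; apply/eqP.
  by apply/esym; apply: contraNF i0 => /eqP ->; rewrite b0.
- rewrite inE (preim_setpart (h S)) /=; set P := preim_partition _ _.
  have pP : is_setpart P := preim_setpart (h S).
  apply/forall_inP => C /(block_pblock pP) [i ->]; rewrite bidx_ge2 //; apply/implyP => bi.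
  have iS : i \notin S.
    apply: contraTN bi => iS; rewrite -eqn0Ngt -leqn0 (bmin_min pP (j:=ord0)) //.
    by rewrite preim_pblock /h iS S0.
  apply/cards1P; exists i; apply/setP => j; rewrite preim_pblock /h inE (negPf iS).
  case: ifP => jS; last exact: eq_sym.
  by apply/eqP/eqP => e; [rewrite e S0 in iS | rewrite -e jS in iS].
- apply/setP => i; rewrite preim_pblock /h S0; case: ifP => [|/negP ni]; first by rewrite eqxx.
  by apply/negbTE/eqP => e; apply: ni; rewrite -e.
Qed.

Lemma card_layered n :
  #|[set P : {set {set 'I_n.+1}} | is_setpart P & layered P]| = 2 ^ n.
Proof.
(* The last element of [S] up to [i]: a block runs from one element of [S] to just before the
   next. *)
pose h (S : {set 'I_n.+1}) (i : 'I_n.+1) := [arg max_(s > ord0 | (s \in S) && (s <= i)) s].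
have hP (S : {set 'I_n.+1}) i : ord0 \in S ->
    [/\ h S i \in S, h S i <= i & forall s : 'I_n.+1, s \in S -> s <= i -> s <= h S i].
  move=> S0; rewrite /h; case: arg_maxnP => [|s /andP[sS si] smax]; first by rewrite S0.
  by split=> // t tS ti; apply: smax; rewrite tS.
have hid (S : {set 'I_n.+1}) i : ord0 \in S -> i \in S -> h S i = i.
  by move=> S0 iS; have [_ le max] := hP S i S0; apply/val_inj/anti_leq; rewrite le max.
have hmono (S : {set 'I_n.+1}) (i j : 'I_n.+1) : ord0 \in S -> i <= j -> h S i <= h S j.
  move=> S0 ij; have [iS le _] := hP S i S0; have [_ _ max] := hP S j S0.
  by apply: max => //; apply: leq_trans ij.
have hr (S : {set 'I_n.+1}) : ord0 \in S -> retraction (h S).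
  by move=> S0 i; have [iS le _] := hP S i S0; split=> //; apply: hid.
apply: (@card_setparts _ _ _ (fun P => [set i | bmin P i == i]) h) => [P|P|P|S S0|S S0].
- by rewrite inE => /andP[].
- by rewrite !inE => /andP[pP _]; rewrite -(inj_eq val_inj) -leqn0 (bmin_le pP ord0).
- rewrite inE => /andP[pP /forall_inP lP].
  set S := [set i | _].
  have S0 : ord0 \in S by rewrite inE -(inj_eq val_inj) -leqn0 (bmin_le pP ord0).
  (* [h S i] lies between [bmin P i] and [i], so it belongs to their block by layeredness; being a
     block minimum, it equals [bmin P i]. *)
  suff hb i : h S i = bmin P i by move=> i j; rewrite pblock_bminE // !hb.
  have [hS hi hmax] := hP S i S0.
  have bS : bmin P i \in S by rewrite inE bmin_idem.
  have le1 := hmax _ bS (bmin_le pP i).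
  have := lP _ (pblock_memT pP i) => /forall_inP /(_ _ (bmin_mem pP i)).
  move/forall_inP/(_ _ (mem_pblockT pP i))/forallP/(_ (h S i)).
  rewrite le1 hi pblock_bminE //= => /eqP ->.
  by move: hS; rewrite inE => /eqP.
- rewrite inE (preim_setpart (h S)) /=; have pP := preim_setpart (h S).
  apply/forall_inP => C /(block_pblock pP) [i ->].
  apply/forall_inP => x; rewrite preim_pblock => /eqP ex.
  apply/forall_inP => z; rewrite preim_pblock => /eqP ez.
  apply/forallP => y; apply/implyP => /andP[xy yz]; rewrite preim_pblock.
  by apply/eqP/val_inj/anti_leq; rewrite [in X in X && _]ex [in X in _ && X]ez !hmono.
- apply/setP => i; rewrite inE bmin_preim; last exact: hr.
  apply/eqP/idP => [<-|]; last exact: hid.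
  by have [] := hP S i S0.
Qed.

(** * Counting the partitions that avoid 12/3 *)

Lemma sorted_ltn_nth_addn (s : seq nat) i d :
  sorted ltn s -> i + d < size s -> nth 0 s i + d <= nth 0 s (i + d).
Proof.
move=> ss; elim: d => [|d IH] lt; first by rewrite !addn0.
rewrite addnS (leq_ltn_trans (IH _)) //; first by rewrite ltnW // -addnS.
apply: (sorted_ltn_nth ltn_trans) => //; rewrite ?inE; lia.
Qed.

Lemma sorted_enum_set n (A : {set 'I_n}) : sorted ltn [seq val i | i <- enum A].
Proof.
rewrite sorted_map /enum_mem sorted_filter //; first by move=> x y z; apply: ltn_trans.
by rewrite -sorted_map -enumT val_enum_ord iota_ltn_sorted.
Qed.

Section StaircaseCode.
Variable n : nat.
Implicit Types (S : {set 'I_n.+1}) (b : 'I_n.+1 -> 'I_n.+1).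

(* If b is a k-staircase, i - b i vanishes for i < k and is strictly increasing
   for i >= k - 1: hence the code has n + 2 - k elements, k can be read off
   from its size, and its sorted list gives back b. *)
Definition staircase_code b : {set 'I_n.+1} :=
  [set inord (i - b i) | i : 'I_n.+1 in 'I_n.+1].

(** Here [n.+2 - #|S|] is the [k] of the staircase. The truncated index is 0 for [i < k], where the
    entry 0 gives [b i = i], and then runs through 1, 2, and so on. *)
Definition staircase_decode S (i : 'I_n.+1) : 'I_n.+1 :=
  inord (i - nth 0 [seq val s | s <- enum S] (i.+1 - (n.+2 - #|S|))).

Lemma staircase_codeK b k : retraction b -> staircase b k -> k <= n.+1 ->
  staircase_decode (staircase_code b) =1 b.
Proof.
move=> rb [bid blt bdec] kn i.
have k0 : 0 < k.
  by rewrite lt0n; apply/eqP => k0; have := blt ord0; rewrite k0 ltn0 => /(_ isT).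
pose g j := j - b (inord j).
have gE (j : 'I_n.+1) : g j = j - b j by rewrite /g inord_val.
(* Starting at [k.-1] lists the value 0, common to all [j < k], exactly once. *)
pose s := [seq g j | j <- iota k.-1 (n.+2 - k)].
have g_small j : j < k -> g j = 0.
  move=> jk; have jn : j < n.+1 by apply: leq_trans kn.
  by rewrite -[j]/(val (Ordinal jn)) gE bid // subnn.
have ss : sorted ltn s.
  rewrite sorted_map; pose r j := k.-1 <= j < n.+1.
  apply: (@sub_in_sorted _ r ltn); last 2 first.
  - by apply/allP => j; rewrite mem_iota /r; lia.
  - exact: iota_ltn_sorted.
  move=> x y /andP[kx xn] /andP[ky yn] /= xy.
  have xn' : x < n.+1 by lia.
  have yn' : y < n.+1 by lia.
  rewrite -[x]/(val (Ordinal xn')) -[y]/(val (Ordinal yn')) !gE /=.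
  have := (rb (Ordinal xn')).1; have := blt (Ordinal yn').
  have := bdec (Ordinal xn') (Ordinal yn'); have := bid (Ordinal xn'); rewrite /=.
  (* From [k] on, the argument grows while [b] does not. For [x = k.-1] the value is 0, and that at
     [y] is positive since [b y < k <= y]. *)
  case: (ltnP x k) => xk; last by lia.
  by move=> -> //= _; lia.
have sE : [seq val s | s <- enum (staircase_code b)] = s.
  apply: (irr_sorted_eq ltn_trans ltnn) => //.
    exact: sorted_enum_set.
  move=> v; apply/mapP/mapP => [[x]|[j]].
    rewrite mem_enum => /imsetP [j _ ->] ->.
    rewrite /= inordK ?ltnS; last by have := ltn_ord j; lia.
    case: (ltnP j k) => jk.
      exists k.-1; first by rewrite mem_iota; lia.
      by rewrite g_small ?bid ?subnn //; lia.
    by exists j; rewrite ?gE // mem_iota; have := ltn_ord j; lia.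
  rewrite mem_iota => jr ->; have jn : j < n.+1 by lia.
  exists (inord (g j)); last by rewrite /= inordK // /g; lia.
  rewrite mem_enum; apply/imsetP; exists (Ordinal jn) => //.
  by rewrite -gE.
have cS : #|staircase_code b| = n.+2 - k.
  by rewrite cardE -(size_map val) sE size_map size_iota.
rewrite /staircase_decode sE cS.
have -> : n.+2 - (n.+2 - k) = k by lia.
apply: val_inj; rewrite /= (nth_map 0) ?size_iota; last by have := ltn_ord i; lia.
rewrite nth_iota; last by have := ltn_ord i; lia.
case: (ltnP i k) => ik.
  rewrite (_ : i.+1 - k = 0); last by lia.
  by rewrite addn0 g_small ?subn0 ?inordK ?bid //; lia.
rewrite (_ : k.-1 + (i.+1 - k) = i); last by lia.
by rewrite gE subKn ?inord_val // (rb i).1.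
Qed.

(** With [m] for [k] and [s] the sorted list of [S], the bounds [j <= s_j < m + j] do the work: the
    lower one keeps decoded values below [m], the upper one prevents truncation in the
    subtraction. *)
Lemma staircase_decodeP S : ord0 \in S ->
  [/\ staircase (staircase_decode S) (n.+2 - #|S|), retraction (staircase_decode S) &
      staircase_code (staircase_decode S) = S].
Proof.
move=> S0; pose s := [seq val x | x <- enum S].
have sz : size s = #|S| by rewrite size_map -cardE.
have ss : sorted ltn s by apply: sorted_enum_set.
have S1 : 0 < #|S| by apply/card_gt0P; exists ord0.
have Sn : #|S| <= n.+1 by rewrite -[leqRHS](card_ord n.+1) max_card.
have memS v : v \in s -> exists2 x : 'I_n.+1, x \in S & v = x.
  by case/mapP => x; rewrite mem_enum => xS ->; exists x.
have s0 : nth 0 s 0 = 0.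
  have : 0 \in s by apply/mapP; exists ord0; rewrite ?mem_enum.
  case/(nthP 0) => j jlt; case: j jlt => // j jlt e.
  have := @sorted_ltn_nth_addn s 0 j.+1 ss; rewrite add0n e => /(_ jlt); lia.
set m := n.+2 - #|S|.
have mE : m + #|S| = n.+2 by rewrite /m; lia.
have m0 : 0 < m by lia.
have lo j : j < size s -> j <= nth 0 s j.
  by move=> lt; have := @sorted_ltn_nth_addn s 0 j ss; rewrite s0 !add0n; apply.
(* The last entry is at most [n], and every step back from it loses at least 1. *)
have hi j : j < size s -> nth 0 s j < m + j.
  move=> lt; have e : j + ((size s).-1 - j) = (size s).-1 by lia.
  have := @sorted_ltn_nth_addn s j ((size s).-1 - j) ss.
  rewrite e prednK ?sz // => /(_ (leqnn _)).
  have /memS [x _ ->] : nth 0 s #|S|.-1 \in s by rewrite mem_nth // sz prednK.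
  have := ltn_ord x; rewrite /m; lia.
have dE (i : 'I_n.+1) : staircase_decode S i = i - nth 0 s (i.+1 - m) :> nat.
  by rewrite /staircase_decode -/s inordK //; have := ltn_ord i; lia.
have bid (i : 'I_n.+1) : i < m -> staircase_decode S i = i.
  by move=> im; apply: val_inj; rewrite /= dE (_ : i.+1 - m = 0) ?s0 ?subn0 //; lia.
have idx (i : 'I_n.+1) : i.+1 - m < size s by have := ltn_ord i; rewrite sz; lia.
have blt (i : 'I_n.+1) : m <= i -> staircase_decode S i < m.
  by move=> im; rewrite dE; have := lo _ (idx i); lia.
have rb : retraction (staircase_decode S).
  move=> i; split; first by rewrite dE leq_subr.
  by apply: (bid _); case: (ltnP i m) => im; [rewrite bid | apply: blt].
split=> //.
  split=> // i j im ij; rewrite !dE.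
  have := @sorted_ltn_nth_addn s (i.+1 - m) (j - i) ss.
  rewrite (_ : i.+1 - m + (j - i) = j.+1 - m); last by lia.
  by move=> /(_ (idx j)); lia.
apply/setP => v; apply/imsetP/idP => [[i _ ->]|vS].
  rewrite dE subKn; last first.
    case: (ltnP i m) => im; first by rewrite (_ : i.+1 - m = 0) ?s0 //; lia.
    by have := hi _ (idx i); lia.
  have /memS [x xS ->] := mem_nth 0 (idx i).
  by rewrite inord_val.
have : val v \in s by apply/mapP; exists v; rewrite ?mem_enum.
case/(nthP 0) => j jlt e.
(* The entry at position [j] is the difference [i - b i] for [i = m - 1 + j]. *)
have jn : m.-1 + j < n.+1 by rewrite sz in jlt; lia.
exists (Ordinal jn) => //; rewrite dE /= (_ : (m.-1 + j).+1 - m = j); last by lia.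
have := hi _ jlt; rewrite e /= => vm.
by rewrite subKn ?inord_val //=; lia.
Qed.

Lemma card_avoid_12_3 :
  #|[set P : {set {set 'I_n.+1}} | is_setpart P & ~~ Rcontains P pat_12_3]| = 2 ^ n.
Proof.
apply: (@card_setparts _ _ _ (fun P => staircase_code (bmin P))
          staircase_decode) => [P|P|P|S S0|S S0].
- by rewrite inE => /andP[].
- rewrite inE => /andP[pP _]; apply/imsetP; exists ord0 => //.
  by apply: val_inj; rewrite /= sub0n inordK.
- rewrite inE => /andP[pP /(avoid_staircase pP) [k st] i j].
  have rb : retraction (bmin P) by move=> x; rewrite bmin_le ?bmin_idem.
  by rewrite !(staircase_codeK rb st) -1?ltnS // pblock_bminE.
- have [st rb _] := staircase_decodeP S0; rewrite inE (preim_setpart (staircase_decode S)) /=.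
  apply: (staircase_avoid (preim_setpart _)) (_ : staircase _ (n.+2 - #|S|)).
  by case: st => h1 h2 h3; split=> *; rewrite !bmin_preim //; [apply: h1 | apply: h2 | apply: h3].
- have [st rb e] := staircase_decodeP S0; rewrite -[RHS]e.
  by apply: eq_imset => i; rewrite bmin_preim.
Qed.

End StaircaseCode.

(** * Matchings *)

Section Matchings.
Variable T : finType.
Implicit Types (D B : {set T}) (P : {set {set T}}).

(** The ground set is an arbitrary [D], so that deleting a block stays within the family. *)
Definition matchings D : {set {set {set T}}} :=
  [set P | partition P D & [forall C in P, #|C| <= 2]].

Lemma matchings0 : #|matchings set0| = 1.
Proof.
rewrite (_ : matchings set0 = [set set0]) ?cards1 //.
apply/setP => P; rewrite !inE partition_set0; case: eqP => //= ->.
by apply/forall_inP => C; rewrite inE.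
Qed.

(** Adding [B] is a bijection from the matchings of [D :\: B] onto those of [D] having [B] as a
    block. *)
Lemma card_matchings_block D B : B \subset D -> B != set0 -> #|B| <= 2 ->
  #|[set P in matchings D | B \in P]| = #|matchings (D :\: B)|.
Proof.
move=> BD B0 B2; rewrite -[RHS](card_in_imset (f := fun Q => B |: Q)).
  apply: eq_card => P; rewrite !inE; apply/andP/imsetP => [[/andP[pP /forall_inP sP] BP]|[Q]].
    exists (P :\ B); last by rewrite setD1K.
    rewrite inE partitionD1 //; apply/forall_inP => C; rewrite inE => /andP[_]; exact: sP.
  rewrite inE => /andP[pQ /forall_inP sQ] ->; rewrite setU11; split=> //; apply/andP; split.
    rewrite (_ : D = B :|: (D :\: B)).
      by apply: partitionU1 => //; rewrite disjoint_sym disjoints_subset subsetDr.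
    by rewrite setDE setUIr setUCr setIT; apply/esym/setUidPr.
  by apply/forall_inP => C; rewrite !inE => /predU1P[->|/sQ].
have noB Q : Q \in matchings (D :\: B) -> B \notin Q.
  rewrite inE => /andP[pQ _]; apply: contra B0 => BQ.
  have : B \subset D :\: B by rewrite -(cover_partition pQ) (bigcup_max B).
  by rewrite subsetD -setI_eq0 setIid => /andP[].
by move=> Q R /noB nQ /noB nR e; rewrite -(setU1K nQ) e setU1K.
Qed.

(** Sort the matchings by the partner [y] of [x], where [y = x] stands for a singleton block. *)
Lemma card_matchings_rec D x : x \in D ->
  #|matchings D| = \sum_(y in D) #|matchings (D :\: [set x; y])|.
Proof.
move=> xD; rewrite -sum1_card.
rewrite (partition_big (fun P => pblock P x) (mem [set [set x; y] | y in D])) /=; last first.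
  move=> P; rewrite inE => /andP[pP /forall_inP sP].
  have xP : x \in cover P by rewrite (cover_partition pP).
  have := sP _ (pblock_mem xP); have xB : x \in pblock P x by rewrite mem_pblock.
  rewrite (cardsD1 x) xB ltnS => c1.
  have : pblock P x = x |: (pblock P x :\ x) by rewrite setD1K.
  have [->|/set0Pn [y yB]] := eqVneq (pblock P x :\ x) set0.
    by rewrite setU0 => ->; apply/imsetP; exists x; rewrite ?setUid.
  have -> : pblock P x :\ x = [set y].
    by apply/esym/eqP; rewrite eqEcard sub1set yB cards1.
  move=> ->; apply/imset_f; rewrite -(cover_partition pP).
  move: yB; rewrite inE => /andP[_ yB].
  by apply/bigcupP; exists (pblock P x); rewrite ?pblock_mem.
rewrite big_imset /=; last first.
  move=> y z _ _ /setP e; have := e y; have := e z; rewrite !inE !eqxx !orbT.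
  by move=> ez /esym/orP[/eqP yx|/eqP //]; move: ez; rewrite yx orbb => /eqP ->.
apply: eq_bigr => y yD; rewrite -card_matchings_block.
- rewrite -sum1_card; apply: eq_bigl => P; rewrite !inE -andbA.
  have [pP|//] := boolP (partition P D); rewrite /=; case: (X in X && _) => //=.
  apply/eqP/idP => [<-|BP]; first by rewrite pblock_mem ?(cover_partition pP).
  by apply: (def_pblock (partition_trivIset pP) BP); rewrite setU11.
- by apply/subsetP => z /set2P[] ->.
- by apply/set0Pn; exists x; rewrite setU11.
- by rewrite cards2; case: (x != y).
Qed.

(** The involution numbers: choose the [2i] paired points, then one of their [dfact i] perfect
    matchings. *)
Definition num_matchings n := \sum_(0 <= i < n.+1) 'C(n, i.*2) * dfact i.

(** Terms with [2i > n] vanish, so sums for different [n] can be brought to matching ranges. *)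
Lemma num_matchings_widen n N : n < N ->
  num_matchings n = \sum_(0 <= i < N) 'C(n, i.*2) * dfact i.
Proof.
move=> nN; rewrite [RHS](big_cat_nat (n := n.+1)) //= [X in _ + X]big_nat_cond.
by rewrite [X in _ + X]big1 ?addn0 // => i ?; rewrite bin_small //; lia.
Qed.

Lemma num_matchingsSS n :
  num_matchings n.+2 = num_matchings n.+1 + n.+1 * num_matchings n.
Proof.
(* Once the term [i = 0] is split off the two longer sums, all three run over [i < n + 2]. *)
rewrite (@num_matchings_widen n.+1 n.+3) // (@num_matchings_widen n n.+2) //.
rewrite /num_matchings ![\sum_(0 <= i < n.+3) _]big_nat_recl // -addnA; congr (_ + _).
rewrite big_distrr -big_split /=; apply: eq_bigr => i _.
(* Pascal's rule splits off the term of M(n+1); the rest follows from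
   [(2i+1) C(n+1, 2i+1) = (n+1) C(n, 2i)]. *)
rewrite doubleS binS mulnDl; congr (_ + _).
rewrite /dfact big_ord_recr /= mulnCA [RHS]mulnA (mul_bin_diag n.+1) /=; lia.
Qed.

Lemma card_matchings D : #|matchings D| = num_matchings #|D|.
Proof.
have [m] := ubnP #|D|; elim: m D => // m IH D; rewrite ltnS => Dm.
have [->|/set0Pn [x xD]] := eqVneq D set0.
  by rewrite matchings0 cards0 /num_matchings big_nat1 /dfact big_ord0.
rewrite (card_matchings_rec xD) (bigD1 x) //= setUid.
have Dx := cardsD1 x D; rewrite xD in Dx.
have -> : \sum_(y in D | y != x) #|matchings (D :\: [set x; y])| =
    #|D :\ x| * num_matchings #|D :\ x|.-1.
  rewrite -sum_nat_const; apply: eq_big => [y|y /andP[yD yx]]; first by rewrite !inE andbC.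
  have e : #|D :\: [set x; y]| = #|D :\ x|.-1.
    by rewrite (cardsD1 y (D :\ x)) !inE yx yD setDDl.
  by rewrite IH e //; lia.
rewrite IH; last by lia.
rewrite Dx add1n; case: #|D :\ x| => [|d]; last by rewrite num_matchingsSS.
(* When [D] is the single point [x], what remains is M(0) = M(1). *)
rewrite mul0n addn0 (@num_matchings_widen 0 2) //.
by apply: eq_big_nat => -[|[|]].
Qed.

End Matchings.

(** * The five descriptions and their counts *)

Theorem theorem4p3 (n : nat) (hn : 1 <= n) :
  [/\ Ravoid_set n pat_1_2_3 = [set P | is_setpart P & #|P| <= 2]
      /\ #|Ravoid_set n pat_1_2_3| = 2 ^ n.-1,
      Ravoid_set n pat_123 = [set P | is_setpart P & matching P]
      /\ #|Ravoid_set n pat_123| = \sum_(0 <= i < n.+1) 'C(n, i.*2) * dfact i,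
      Ravoid_set n pat_12_3 = [set P | is_setpart P & cond3 P]
      /\ #|Ravoid_set n pat_12_3| = 2 ^ n.-1,
      Ravoid_set n pat_1_23 =
        [set P | is_setpart P & [forall C in P, (2 <= bidx P C) ==> (#|C| == 1)]]
      /\ #|Ravoid_set n pat_1_23| = 2 ^ n.-1
    & Ravoid_set n pat_13_2 = [set P | is_setpart P & layered P]
      /\ #|Ravoid_set n pat_13_2| = 2 ^ n.-1].
Proof.
case: n hn => // n _.
have ravoidE (pi : {set {set 'I_3}}) (q : pred {set {set 'I_n.+1}}) :
    (forall P, is_setpart P -> ~~ Rcontains P pi = q P) ->
    Ravoid_set n.+1 pi = [set P | is_setpart P & q P].
  by move=> piE; apply/setP => P; rewrite !inE; apply: andb_id2l => /piE.
have e1 := @ravoidE pat_1_2_3 (fun P => #|P| <= 2).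
have e2 := @ravoidE pat_123 (fun P => matching P).
have e3 := @ravoidE pat_12_3 (fun P => cond3 P).
have e4 := @ravoidE pat_1_23 (fun P => [forall C in P, (2 <= bidx P C) ==> (#|C| == 1)]).
have e5 := @ravoidE pat_13_2 (fun P => layered P).
split; split.
- by apply: e1 => P pP; rewrite Rcontains_1_2_3 // -leqNgt.
- by rewrite e1 ?card_two_blocks // => P pP; rewrite Rcontains_1_2_3 // -leqNgt.
- by apply: e2 => P pP; rewrite Rcontains_123 // negbK.
- rewrite e2 => [|P pP]; last by rewrite Rcontains_123 // negbK.
  (* Reading [n.+1] as the size of the full set turns the right side into the number of its
     matchings, which is the left side up to unfolding. *)
  by rewrite -[n.+1 in RHS]card_ord -cardsT -/(num_matchings _) -card_matchings.
- by apply: e3 => P; apply: avoid_12_3E.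
- exact: card_avoid_12_3.
- by apply: e4 => P pP; rewrite Rcontains_1_23 // negbK.
- by rewrite e4 ?card_nonfirst_singletons // => P pP; rewrite Rcontains_1_23 // negbK.
- by apply: e5 => P pP; rewrite Rcontains_13_2 // negbK.
- by rewrite e5 ?card_layered // => P pP; rewrite Rcontains_13_2 // negbK.
Qed.
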